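(* Let $u$ be an upcycle for $\{0,1,\ldots,a-1\}^n$ with diamondicity $d$. Then for every integer $k\ge 1$ there exists (and can be constructed from $u$) an upcycle for $\{0,1,\ldots,ak-1\}^n$ with diamondicity $d$.
   Context: Let $A=\{0,\dots,a-1\}$, $a\ge 2$, be an alphabet and $\diamond\notin A$ a wildcard symbol (''diamond''). A partial word is a finite sequence over $A\cup\{\diamond\}$; a cyclic partial word $(u_1\cdots u_N)$ is cyclically ordered, with indices taken modulo $N$. A partial word $x$ covers a word $y$ of the same length if for each $i$ either $x_i=\diamond$ or $x_i=y_i$. For $n\ge 1$, the window of $u$ at position $i\in\{1,\dots,N\}$ is $u_i\cdots u_{i+n-1}$. An upcycle for $A^n$ is a cyclic partial word $u=(u_1\cdots u_N)$ such that each word of $A^n$ is covered by the window at exactly one position $i\in\{1,\dots,N\}$. It is known that the diamonds of an upcycle are $n$-periodic ($u_i=\diamond$ implies $u_{i+n}=\diamond$), so all windows contain the same number $d$ of diamonds, called the diamondicity of $u$. *)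

(* Defs.v *)
From mathcomp Require Import all_boot.

Set Implicit Arguments.
Unset Strict Implicit.
Unset Printing Implicit Defensive.

(* Partial words over A have letters in [option A]; [None] is the diamond.
   A cyclic partial word (u_1 ... u_N) is given by a sequence u of length
   N = size u, with positions 0, ..., N - 1 taken modulo N. *)

Section Upcycles.

Variables (A : eqType) (n : nat).

Implicit Types (u : seq (option A)) (x : n.-tuple (option A)) (w : n.-tuple A).

Definition covers x w : bool :=
  [forall j : 'I_n, (tnth x j == None) || (tnth x j == Some (tnth w j))].

(* The default [None] of [nth] is never returned: a position i : 'I_(size u)
   exists only if u is nonempty, and the index is then smaller than [size u]. *)
Definition window u (i : 'I_(size u)) : n.-tuple (option A) :=
  [tuple nth None u ((i + j) %% size u) | j < n].

Definition upcycle u : Prop :=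
  forall w : n.-tuple A, exists! i : 'I_(size u), covers (window i) w.

Definition has_diamondicity u (d : nat) : Prop :=
  forall i : 'I_(size u), count_mem None (window i) = d.

End Upcycles.

Arguments window {A} n u i.
Arguments upcycle {A} n u.
Arguments has_diamondicity {A} n u d.

(* Main.v *)
(** Let [K] have [k] letters and let [N] be the length of [u]. An upcycle
    over [A * K], an alphabet with [ak] letters, is obtained by running
    through [u] several times while attaching to each non-diamond letter a
    symbol of [K], in such a way that the windows starting at positions
    congruent to [p] modulo [N] carry every attachment to the non-diamonds
    of the window of [u] at [p] exactly once. Such an attachment is an
    Eulerian tour of a graph whose edges are the pairs (position modulo
    [N], attached window). The graph is balanced because the diamonds of
    [u] are [n]-periodic: rotating the window sends each edge to a
    following one, bijectively. An Eulerian tour is a choice of following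
    edges with a single orbit; it is found by minimizing the number of
    orbits, since exchanging the images of two edges with the same head in
    different orbits joins these. *)

Require Import Defs.
From mathcomp Require Import all_boot all_fingroup.
From mathcomp Require Import zify.

Set Implicit Arguments.
Unset Strict Implicit.
Unset Printing Implicit Defensive.

(* The tail of an edge [e] is [tl e] and its head is [tl (s0 e)]. *)
Lemma perm_joining_adjacent (E : finType) (T : eqType) (tl : E -> T)
    (s0 : {perm E}) :
  exists s : {perm E}, (forall e, tl (s e) = tl (s0 e)) /\
    (forall e e', tl (s0 e) = tl e' -> e' \in porbit s e).
Proof.
pose P (s : {perm E}) := [forall e, tl (s e) == tl (s0 e)].
have P0 : P s0 by apply/forallP.
case: (@arg_minnP _ s0 P (fun s => #|porbits s|) P0) => s /forallP Ps smin.
have sE e : tl (s e) = tl (s0 e) by apply/eqP.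
exists s; split=> // e e' ee'.
(* The edges [f] and [e] have the same head. If they lay in different orbits, swapping their images
   would preserve all heads and lower the number of orbits by one. *)
pose f := (s^-1)%g e'.
have sf : s f = e' by rewrite /f permKV.
have hdf : tl (s0 f) = tl (s0 e) by rewrite -sE sf ee'.
suff fe : f \in porbit s e.
  have /eqP <- : porbit s f == porbit s e by rewrite eq_porbit_mem.
  by rewrite -sf -eq_porbit_mem -{2}(expg1 s) porbit_perm.
apply/negPn/negP=> nfe.
have Pt : P (tperm f e * s)%g.
  by apply/forallP=> x; rewrite permM sE; case: tpermP => [->|->|];
     rewrite ?hdf.
have := smin _ Pt; have := porbits_mul_tperm s f e.
by rewrite nfe; case: (f != e) => /=; lia.
Qed.

(** * Eulerian tour of the attached windows *)

Section PeriodicWindows.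

Variables (K : finType) (c0 : K) (N n : nat) (D : pred nat).
Hypotheses (N_gt0 : 0 < N) (n_gt0 : 0 < n).
Hypotheses (D_modN : forall i, D (i %% N) = D i).
Hypotheses (D_addn : forall i, D (i + n) = D i).

(* Attached symbols at diamonds are normalized to [c0]. *)
Definition edge_pred (e : 'I_N * {ffun 'I_n -> K}) :=
  [forall j : 'I_n, D (e.1 + j) ==> (e.2 j == c0)].

Definition edge := {e | edge_pred e}.

Lemma D_congr i i' : i = i' %[mod N] -> D i = D i'.
Proof. by move=> ii'; rewrite -D_modN ii' D_modN. Qed.

Definition rot_pair (e : 'I_N * {ffun 'I_n -> K}) :=
  (ordS e.1, [ffun j : 'I_n => e.2 (ordS j)]).

Lemma rot_pairP (e : edge) : edge_pred (rot_pair (val e)).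
Proof.
case: e => -[p x] /= /forallP xP; apply/forallP=> j /=.
rewrite ffunE; have /= := xP (ordS j).
suff -> : D (p.+1 %% N + j) = D (p + j.+1 %% n) by [].
rewrite (@D_congr (p.+1 %% N + j) (p + j.+1)) ?modnDml ?addSnnS //.
(* Only the wrap-around index [j = n - 1] needs the [n]-periodicity of [D]. *)
have := ltn_ord j; rewrite leq_eqVlt => /orP[/eqP->|lt_jn].
  by rewrite modnn addn0 D_addn.
by rewrite modn_small.
Qed.

Definition rot_edge (e : edge) : edge := Sub _ (rot_pairP e).

Lemma rot_edge_inj : injective rot_edge.
Proof.
move=> [[p x] pxP] [[q y] qyP] /(congr1 val) [] ordS_pq /ffunP xy.
have pq : p = q by apply/ordS_inj/val_inj.
apply: val_inj; rewrite /= pq; congr pair; apply/ffunP=> j.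
by have := xy (ord_pred j); rewrite !ffunE ord_predK.
Qed.

(** A vertex is a position with [n - 1] symbols; overwriting the last symbol by [c0] keeps the type
    of length-[n] windows. *)
Definition edge_tail (e : edge) : 'I_N * {ffun 'I_n -> K} :=
  ((val e).1, [ffun j : 'I_n => if j.+1 < n then (val e).2 j else c0]).

Definition edge_at_pair (y : nat -> K) i : 'I_N * {ffun 'I_n -> K} :=
  (Ordinal (ltn_pmod i N_gt0),
   [ffun j : 'I_n => if D (i + j) then c0 else y (i + j)]).

Lemma edge_at_pairP y i : edge_pred (edge_at_pair y i).
Proof.
apply/forallP=> j /=; rewrite ffunE (@D_congr _ (i + j)) ?modnDml //.
by apply/implyP=> ->.
Qed.

Definition edge_at y i : edge := Sub _ (edge_at_pairP y i).

Lemma edge_at_adjacent y i :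
  edge_tail (rot_edge (edge_at y i)) = edge_tail (edge_at y i.+1).
Proof.
congr pair; first by apply: val_inj; rewrite /= -addn1 modnDml addn1.
apply/ffunP=> j; rewrite !ffunE /=; case: ifP => // jn.
by rewrite modn_small // addSnnS.
Qed.

(** Strong connectivity: sliding a window along a sequence that contains both attachments is a walk
    from [e] to [e']. *)
Lemma edge_at_connect (e e' : edge) :
  exists y i m, edge_at y i = e /\ edge_at y (i + m) = e'.
Proof.
case: e e' => [[p x] pxP] [[q z] qzP].
(* A position congruent to [q] modulo [N], far enough right for the two windows to be disjoint. *)
pose Q := q + N * n.+1.
have ltpQ : p + n <= Q by rewrite /Q; have := ltn_ord p; nia.
pose get (f : {ffun 'I_n -> K}) j := if insub j is Some j' then f j' else c0.
have getE f (j : 'I_n) : get f j = f j by rewrite /get valK.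
pose y i := if i < Q then get x (i - p) else get z (i - Q).
exists y, p, (Q - p); rewrite subnKC; last by lia.
split; apply: val_inj => /=; congr pair.
- by apply: val_inj; rewrite /= modn_small.
- apply/ffunP=> j; rewrite ffunE /y.
  have -> : p + j < Q by have := ltn_ord j; lia.
  rewrite addKn getE; case: ifP => // Dj.
  by have /forallP/(_ j)/implyP/(_ Dj)/eqP := pxP.
- by apply: val_inj; rewrite /= /Q addnC mulnC modnMDl modn_small.
apply/ffunP=> j; rewrite ffunE /y ltnNge leq_addr addKn getE.
case: ifP => // Dj.
have Dj' : D (q + j).
  by rewrite (@D_congr _ (Q + j)) // /Q -addnA addnCA mulnC modnMDl.
by have /forallP/(_ j)/implyP/(_ Dj')/eqP := qzP.
Qed.

Lemma edge_tour : exists s : {perm edge},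
  (forall e, edge_tail (s e) = edge_tail (rot_edge e)) /\
  (forall e e', e' \in porbit s e).
Proof.
have [s [sE sadj]] := perm_joining_adjacent edge_tail (perm rot_edge_inj).
exists s; split=> [e|e e']; first by rewrite sE permE.
have [y [i [m [<- <-]]]] := edge_at_connect e e'.
elim: m => [|m IHm]; first by rewrite addn0 porbit_id.
move: IHm; rewrite -!eq_porbit_mem => /eqP <-; rewrite eq_porbit_mem.
by apply: sadj; rewrite permE addnS edge_at_adjacent.
Qed.

(* [y] is an [(m, M)]-perfect necklace once the diamonds are removed, where
   [m] and [M] are the numbers of non-diamonds in a window and in a period. *)
Lemma periodic_window_lift : exists (L : nat) (y : nat -> K),
  [/\ N %| L, forall i, y (i %% L) = y i &
   forall (p : 'I_N) (z : 'I_n -> K), exists! i : 'I_L,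
     i %% N = p /\ forall j : 'I_n, ~~ D (p + j) -> y (i + j) = z j].
Proof.
have [s [sE sT]] := edge_tour.
pose e0 := edge_at (fun=> c0) 0; pose L := #|porbit s e0|.
(* Each edge of the tour contributes its first symbol; by adjacency the next [n - 1] edges supply
   the rest of its window. *)
pose e_ i := iter i s e0; pose y i : K := (val (e_ i)).2 (Ordinal n_gt0).
have eS i : edge_tail (e_ i.+1) = edge_tail (rot_edge (e_ i)) by rewrite /= sE.
have e1 i : (val (e_ i)).1 = i %% N :> nat.
  elim: i => [|i IHi]; first by rewrite /= mod0n.
  by have [-> _] := eS i; rewrite /= IHi -addn1 modnDml addn1.
have e2 i (j : 'I_n) : (val (e_ i)).2 j = y (i + j).
  case: j => j; elim: j i => [|j IHj] i ltjn.
    by rewrite addn0 /y; congr (_ _); apply: val_inj.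
  have ltjn' := ltnW ltjn.
  have [_ /ffunP/(_ (Ordinal ltjn'))] := eS i.
  rewrite !ffunE /= ltjn -/(e_ i.+1) -[LHS]/((val (e_ i.+1)).2 _) IHj.
  rewrite addSnnS => ->.
  by congr (_ _); apply: val_inj; rewrite /= modn_small.
have eL : e_ L = e0 by apply: iter_porbit.
have e_mod i : e_ (i %% L) = e_ i.
  rewrite {2}(divn_eq i L) addnC /e_ iterD; congr (iter _ _ _).
  by elim: (i %/ L) => //= m IHm; rewrite mulSn iterD -IHm; apply: esym.
have L_gt0 : 0 < L by apply/card_gt0P; exists e0; apply: porbit_id.
exists L, y; split=> [|i|p z]; first by rewrite /dvdn -e1 eL /= mod0n.
  by rewrite /y e_mod.
(* Normalizing [z] at the diamonds gives the one edge to look for; the tour meets it exactly once in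
   [L] steps. *)
have pzP : edge_pred (p, [ffun j : 'I_n => if D (p + j) then c0 else z j]).
  by apply/forallP=> j /=; rewrite ffunE; apply/implyP=> ->.
pose e : edge := Sub _ pzP.
have : e \in porbit s e0 by apply: sT.
rewrite porbit_traject => /trajectP[i0 lti0 ei0].
exists (Ordinal lti0); split=> [|i [ip iz]] /=.
  rewrite -e1 /e_ -ei0; split=> // j /negPf Dj.
  by rewrite -e2 /e_ -ei0 ffunE Dj.
have ei : e_ i = e.
  have pE : (val (e_ i)).1 = p by apply: val_inj; rewrite /= e1.
  apply: val_inj; rewrite [LHS]surjective_pairing pE; congr pair.
  apply/ffunP=> j; rewrite ffunE; case: ifPn => Dj; last by rewrite e2 iz.
  by have /forallP/(_ j)/implyP := valP (e_ i); rewrite pE => /(_ Dj)/eqP.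
apply: val_inj => /=; apply/eqP.
rewrite -(nth_uniq e0 _ _ (uniq_traject_porbit s e0)) ?size_traject //.
by rewrite !nth_traject // -ei0 -/(e_ i) ei.
Qed.

End PeriodicWindows.

(** * From the tour to an upcycle over pairs *)

(** The windows at [i] and [i + 1] hold equally many diamonds, and differ only by losing entry [i]
    and gaining entry [i + n]. *)
Lemma nth_mod_addn_diamond (A : eqType) (n d : nat) (u : seq (option A)) i :
  0 < size u -> has_diamondicity n u d ->
  (nth None u ((i + n) %% size u) == None) = (nth None u (i %% size u) == None).
Proof.
move=> u_gt0 hd.
pose D i := nth None u (i %% size u) == None.
have DE m : \sum_(0 <= j < n) D (m + j) = d.
  rewrite big_mkord -(hd (Ordinal (ltn_pmod m u_gt0))) -sum1_count big_tuple.
  rewrite [RHS]big_mkcond; apply: eq_bigr => j _.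
  by rewrite tnth_mktuple /= modnDml /D; case: (_ == None).
case: n {hd} DE => [|n] DE; first by rewrite addn0.
have := DE i; rewrite -(DE i.+1) big_nat_recl // [RHS]big_nat_recr //= addn0.
under eq_bigr => j _ do rewrite addnS -addSn.
rewrite addnC => /addnI; rewrite addSnnS -/(D i) -/(D (i + n.+1)).
by case: (D i); case: (D _).
Qed.

Lemma upcycle_prod (A : eqType) (K : finType) (n d : nat) (u : seq (option A)) :
    0 < n -> A -> K -> upcycle n u -> has_diamondicity n u d ->
  exists v : seq (option (A * K)), upcycle n v /\ has_diamondicity n v d.
Proof.
move=> n_gt0 a0 c0 hu hd.
have u_gt0 : 0 < size u.
  by have [i _] := hu [tuple a0 | _ < n]; apply: leq_ltn_trans (ltn_ord i).
pose D i := nth None u (i %% size u) == None.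
have [||L [y [uL y_mod yP]]] :=
  @periodic_window_lift K c0 (size u) n D u_gt0 n_gt0.
- by move=> i; rewrite /D modn_mod.
- by move=> i; apply: nth_mod_addn_diamond hd.
pose v := mkseq (fun i => omap (pair^~ (y i)) (nth None u (i %% size u))) L.
have sz_v : size v = L by rewrite size_mkseq.
have windowE (i : 'I_(size v)) (p : 'I_(size u)) (j : 'I_n) : i %% size u = p ->
    tnth (window n v i) j = omap (pair^~ (y (i + j))) (tnth (window n u p) j).
  move=> ip; have i_lt := ltn_ord i.
  rewrite !tnth_mktuple.
  have -> : (i + j) %% size v = (i + j) %% L by congr modn.
  rewrite nth_mkseq; last by rewrite ltn_mod; lia.
  (* As [size u] divides [L], wrapping around [v] is compatible with wrapping around [u]. *)
  by rewrite y_mod modn_dvdm // -ip modnDml.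
have tnthD (p : 'I_(size u)) (j : 'I_n) :
    (tnth (window n u p) j == None) = D (p + j) by rewrite tnth_mktuple.
have coversE (i : 'I_(size v)) (p : 'I_(size u)) (w : n.-tuple (A * K)) :
  i %% size u = p ->
  covers (window n v i) w <->
  covers (window n u p) (map_tuple fst w) /\
  forall j : 'I_n, ~~ D (p + j) -> y (i + j) = (tnth w j).2.
  move=> ip; split=> [/forallP cw|[/forallP cw1 cw2]].
    split=> [|j];
      first (apply/forallP=> j; rewrite [tnth (map_tuple _ _) j]tnth_map);
      move: (cw j); rewrite (windowE _ _ _ ip) -?tnthD;
      case: (tnth (window n u p) j) => //= a;
      by rewrite (inj_eq Some_inj) => /eqP <-.
  apply/forallP=> j; have := cw1 j; have := cw2 j.
  rewrite (windowE _ _ _ ip) -tnthD [tnth (map_tuple _ _) j]tnth_map.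
  case: (tnth (window n u p) j) => //= a /(_ isT) -> /eqP[->].
  by case: (tnth w j).
exists v; split=> [w|i].
  (* The first components of [w] determine the position modulo [size u]; the second components then
     determine it modulo [L]. *)
  have [p [cp p_uniq]] := hu (map_tuple fst w).
  have [i [[ip iw] i_uniq]] := yP p (fun j => (tnth w j).2).
  exists (cast_ord (esym sz_v) i); split=> [|i' ci'].
    by apply/(coversE _ p).
  have [cp' iw'] := (coversE _ (Ordinal (ltn_pmod i' u_gt0)) w erefl).1 ci'.
  have ip' := p_uniq _ cp'; rewrite -ip' in iw'.
  have := i_uniq (cast_ord sz_v i') (conj _ iw').
  rewrite ip' => /(_ erefl) ->; exact: cast_ordK.
pose p := Ordinal (ltn_pmod i u_gt0).
rewrite -(hd p) -!sum1_count !big_tuple big_mkcond [RHS]big_mkcond.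
apply: eq_bigr => j _; rewrite (windowE _ p) //.
by case: (tnth _ j).
Qed.

(** * Renaming the letters *)

Lemma tnth_window_map (A B : eqType) (g : A -> B) (n : nat)
    (u : seq (option A)) (i : 'I_(size (map (omap g) u))) (i' : 'I_(size u)) j :
  i = i' :> nat ->
  tnth (window n (map (omap g) u) i) j = omap g (tnth (window n u i') j).
Proof.
move=> ii'; rewrite !tnth_mktuple ii'.
have -> : (i' + j) %% size (map (omap g) u) = (i' + j) %% size u.
  by rewrite size_map.
by rewrite (nth_map None) // ltn_mod; apply: leq_trans (ltn_ord i').
Qed.

Lemma upcycle_map (A B : eqType) (g : A -> B) (n : nat) (u : seq (option A)) :
  bijective g -> upcycle n u -> upcycle n (map (omap g) u).
Proof.
move=> [h gK hK] hu w.
have sz : size u = size (map (omap g) u) by rewrite size_map.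
have coversE (i : 'I_(size (map (omap g) u))) (i' : 'I_(size u)) :
    i = i' :> nat ->
    covers (window n (map (omap g) u) i) w
    = covers (window n u i') (map_tuple h w).
  move=> ii'; apply: eq_forallb => j; rewrite (tnth_window_map _ ii').
  rewrite [tnth (map_tuple _ _) j]tnth_map.
  case: (tnth _ j) => //= b.
  by rewrite !(inj_eq Some_inj) (can2_eq gK hK).
have [i [ci i_uniq]] := hu (map_tuple h w).
exists (cast_ord sz i); split=> [|i' ci']; first by rewrite (coversE _ i).
have /i_uniq -> : covers (window n u (cast_ord (esym sz) i')) (map_tuple h w).
  by rewrite -(coversE i').
exact: cast_ordKV.
Qed.

Lemma has_diamondicity_map (A B : eqType) (g : A -> B) (n d : nat)
    (u : seq (option A)) :
  has_diamondicity n u d -> has_diamondicity n (map (omap g) u) d.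
Proof.
move=> hd i; have sz : size (map (omap g) u) = size u by rewrite size_map.
rewrite -(hd (cast_ord sz i)) -!sum1_count !big_tuple.
rewrite big_mkcond [RHS]big_mkcond.
apply: eq_bigr => j _.
rewrite (@tnth_window_map _ _ _ _ _ _ (cast_ord sz i)) //.
by case: (tnth _ j).
Qed.

Theorem corollary5p2 (a n d : nat) (ha : 2 <= a) (hn : 1 <= n)
  (u : seq (option 'I_a)) (hu : upcycle n u) (hd : has_diamondicity n u d)
  (k : nat) (hk : 1 <= k) :
  exists v : seq (option 'I_(a * k)), upcycle n v /\ has_diamondicity n v d.
Proof.
have [v [vu vd]] := upcycle_prod hn (Ordinal (ltnW ha)) (Ordinal hk) hu hd.
have cardE : #|{: 'I_a * 'I_k}| = a * k by rewrite card_prod !card_ord.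
pose g x := cast_ord cardE (enum_rank x).
have g_bij : bijective g.
  exists (fun i => enum_val (cast_ord (esym cardE) i)) => x.
    by rewrite /g cast_ordK enum_rankK.
  by rewrite /g enum_valK cast_ordKV.
exists (map (omap g) v); split; first exact: upcycle_map.
exact: has_diamondicity_map.
Qed.
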